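(* Let $u^\dagger$ and $u_0$ be images on $\Omega$ with $\int_\Omega u^\dagger\,dx=\int_\Omega u_0\,dx$, let $v=\nabla u^\dagger$, and let $\delta_1=\|u^\dagger-u_0\|_2$. Then $u^\dagger$ is the unique solution of the minimization problem $$\min_u\ \|\,|\nabla u-v|\,\|_1\quad\text{subject to}\quad \|u-u_0\|_2\le\delta_1 .$$
   Context: $\Omega\subset\mathbb{R}^2$ is a bounded domain (open and connected). The noisy image $u_0$ is a real-valued function in $L^2(\Omega)$. The ground truth $u^\dagger$ and the competitors $u$ in the minimization range over $L^2(\Omega)\cap BV(\Omega)$. $\nabla u$ is the distributional gradient, a finite $\mathbb{R}^2$-valued Radon measure on $\Omega$. $v$ denotes a finite $\mathbb{R}^2$-valued Radon measure on $\Omega$; $L^1$ vector fields are identified with the corresponding measures. $\|w\|_2$ is the $L^2(\Omega)$ norm. $\|\,|w|\,\|_1$ is the $L^1(\Omega)$ norm of the pointwise Euclidean norm of the vector field $w$, i.e. $\int_\Omega|w|\,dx$, understood as the total variation $|w|(\Omega)$ when $w$ is a measure. *)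

(* Defs.v *)
From HB Require Import structures.
From mathcomp Require Import all_boot all_order all_algebra.
From mathcomp Require Import all_classical all_reals all_analysis.

Set Implicit Arguments.
Unset Strict Implicit.
Unset Printing Implicit Defensive.

Import Order.TTheory GRing.Theory Num.Theory.
Import numFieldNormedType.Exports.

Local Open Scope classical_set_scope.
Local Open Scope ring_scope.

(* [R * R] with the Borel sigma-algebra. The carrier is convertible to [R * R],
   on which topological notions are stated. *)
Notation plane R := (measurableTypeR R * measurableTypeR R)%type.

Section defs.
Context {R : realType}.
Implicit Types (Omega : set (R * R)) (u phi : R * R -> R).

Definition bounded_domain Omega : Prop :=
  [/\ open Omega, connected Omega & bounded_set Omega].

Definition leb2 : {measure set (plane R) -> \bar R} :=
  (lebesgue_measure \x lebesgue_measure)%E.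

(* Elements of L^p(Omega) are handled through representatives u, of which only
   the values in Omega matter: u \_ Omega is u extended by 0 outside Omega. *)
Definition in_Lp (p : \bar R) Omega u : Prop := u \_ Omega \in Lfun leb2 p.

Definition L2norm Omega u : \bar R := ('N[leb2]_2[EFin \o (u \_ Omega)])%E.

Definition ae_eq_on Omega u1 u2 : Prop :=
  {ae leb2, forall x, Omega x -> u1 x = u2 x}.

Definition partial1 phi : R * R -> R :=
  fun x => derive1 (fun t => phi (t, x.2)) x.1.

Definition partial2 phi : R * R -> R :=
  fun x => derive1 (fun t => phi (x.1, t)) x.2.

Fixpoint Ck (k : nat) phi : Prop :=
  continuous phi /\
  if k is k'.+1 then
    [/\ forall x : R * R, derivable (fun t : R => phi (t, x.2)) x.1 1,
        forall x : R * R, derivable (fun t : R => phi (x.1, t)) x.2 1,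
        Ck k' (partial1 phi) &
        Ck k' (partial2 phi)]
  else True.

(* C_c^oo(Omega), each function being extended by 0 to the whole plane *)
Definition test_function Omega phi : Prop :=
  let support := closure [set x | phi x != 0] in
  [/\ forall k, Ck k phi, compact support & support `<=` Omega].

(* A finite R^2-valued Radon measure on Omega is represented by its two
   components, each being a charge on the plane of which only the values on the
   measurable subsets of Omega are used; a measure on Omega is represented by
   its extension by 0. Finite Borel charges on the plane are always Radon. *)
Definition vmeasure : Type :=
  ({charge set (plane R) -> \bar R} * {charge set (plane R) -> \bar R})%type.

Definition vmeasure0 : vmeasure := (czero : {charge set (plane R) -> \bar R},
   czero : {charge set (plane R) -> \bar R}).

Definition vmeasure_sub (w v : vmeasure) : vmeasure :=
  (cadd w.1 (copp v.1) : {charge set (plane R) -> \bar R},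
   cadd w.2 (copp v.2) : {charge set (plane R) -> \bar R}).

Definition vmeasure_eq Omega (w v : vmeasure) : Prop :=
  forall A : set (plane R), measurable A -> A `<=` Omega ->
    w.1 A = v.1 A /\ w.2 A = v.2 A.

Definition euclidean_norm (a b : R) : R := Num.sqrt (a ^+ 2 + b ^+ 2).

(* |w|(Omega), as a supremum over the countable measurable partitions *)
Definition total_variation_on Omega (w : vmeasure) : \bar R :=
  ereal_sup [set s : \bar R | exists F : nat -> set (plane R),
    [/\ forall i, measurable (F i), trivIset setT F,
        \bigcup_i F i = Omega &
        s = (\sum_(i <oo)
          (euclidean_norm (fine (w.1 (F i))) (fine (w.2 (F i))))%:E)%E]].

Lemma Hahn_decomposition_sig (nu : {charge set (plane R) -> \bar R}) :
  {PN : set (plane R) * set (plane R) | hahn_decomposition nu PN.1 PN.2}.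
Proof.
by apply: cid; have [P [N nuPN]] := Hahn_decomposition nu; exists (P, N).
Qed.

(* The integral against a signed measure, through its Jordan decomposition;
   the latter does not depend on the chosen Hahn decomposition. *)
Definition charge_integral (nu : {charge set (plane R) -> \bar R}) Omega phi
    : \bar R :=
  let nuPN := proj2_sig (Hahn_decomposition_sig nu) in
  (\int[jordan_pos nuPN]_(x in Omega) (phi x)%:E -
   \int[jordan_neg nuPN]_(x in Omega) (phi x)%:E)%E.

Definition is_gradient Omega u (w : vmeasure) : Prop :=
  forall phi, test_function Omega phi ->
    (\int[leb2]_(x in Omega) (u x * partial1 phi x)%:E =
       - charge_integral w.1 Omega phi)%E /\
    (\int[leb2]_(x in Omega) (u x * partial2 phi x)%:E =
       - charge_integral w.2 Omega phi)%E.

Definition in_BV Omega u : Prop :=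
  in_Lp 1%E Omega u /\ exists w, is_gradient Omega u w.

(* The distributional gradient of u in BV(Omega), which is unique as a measure
   on Omega, i.e., up to [vmeasure_eq Omega]; junk value outside of BV(Omega). *)
Definition gradient Omega u : vmeasure :=
  if pselect (exists w, is_gradient Omega u w) is left ex_w
  then projT1 (cid ex_w) else vmeasure0.

(* The objective || |grad u - v| ||_1 *)
Definition objective Omega (v : vmeasure) u : \bar R :=
  total_variation_on Omega (vmeasure_sub (gradient Omega u) v).

Definition feasible Omega u0 (delta : \bar R) u : Prop :=
  [/\ in_Lp 2%E Omega u, in_BV Omega u &
      (L2norm Omega (u \- u0)%R <= delta)%E].

Definition is_solution Omega u0 v (delta : \bar R) u : Prop :=
  feasible Omega u0 delta u /\
  forall u', feasible Omega u0 delta u' ->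
    (objective Omega v u <= objective Omega v u')%E.

End defs.

(* Main.v *)
Require Import Defs.
From mathcomp Require Import all_boot all_order all_algebra.
From mathcomp Require Import all_classical all_reals all_analysis.
From mathcomp Require Import measurable_realfun ring lra.

Set Implicit Arguments.
Unset Strict Implicit.
Unset Printing Implicit Defensive.

Import Order.TTheory GRing.Theory Num.Theory.
Import numFieldNormedType.Exports.

Local Open Scope classical_set_scope.
Local Open Scope ring_scope.

(** The minimizer is [udag] because the objective is nonnegative and vanishes
    at [udag], whose gradient is [v]. Conversely, let [u] be another minimizer.
    Its objective is then 0 too, so that the gradient of [u] agrees with [v],
    hence with the gradient of [udag], on every measurable subset of the
    domain: a set [A] on which they differed would contribute a positive term
    to the partition into [A] and its complement ([total_variation_sub_le0]).
    So [u - udag] has zero distributional gradient and, the domain being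
    connected, is almost everywhere equal to a constant [k]
    ([equal_gradients_ae_const]). But [udag - u0] has mean zero, hence is
    orthogonal to the constants, and Pythagoras gives
    [||u - u0||^2 = ||udag - u0||^2 + k^2 |Omega|]. The constraint on [u]
    leaves only [k = 0] ([mean_zero_translation]).

    The analytic core is that an integrable [w] with zero distributional
    gradient on a connected open set is almost everywhere constant
    ([zero_gradient_ae_const]). Only test functions of the form [F(x1) g(x2)]
    are used. If two smooth functions [F] and [s] vanish on the left of an
    interval and are constant on its right, equal to [L] and [1] respectively,
    then [F - L s] has compact support, whence
    [\int w F'(x1) g(x2) = L \int w s'(x1) g(x2)]. Doing this in both variables
    shows that [\int w F'(x1) G'(x2)] is proportional to the product of the
    total rises of [F] and [G]. When [F'] and [G'] run through bounded smooth
    approximations of the indicator functions of two intervals, dominated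
    convergence turns this into: the integral of [w] over a rectangle is
    proportional to the area of the rectangle ([pairing_rectangle]). The
    pi-lambda theorem extends this to all Borel subsets of a rectangle, so that
    [w] is almost everywhere constant on it ([ae_cst_of_rectangles]). Finally
    the constants of overlapping open sets coincide because nonempty open sets
    have positive measure, connectedness makes all of them equal, and a
    countable base of squares keeps the exceptional set negligible
    ([ae_const_connected]). *)

(** * Smooth functions of one real variable *)

Section smooth.
Context {R : realType}.
Implicit Types (f g : R -> R) (k : nat).

(** The class of [k] times continuously differentiable functions, in the same
    recursive form as [Ck] on the plane, so that the latter can be deduced for
    products of functions of one variable by a parallel induction. *)
Fixpoint C1k k f : Prop :=
  continuous f /\
  if k is k'.+1 then
    (forall x : R, derivable f x (1 : R)) /\ C1k k' (derive1 f)
  else True.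

Definition smooth f := forall k, C1k k f.

Lemma derivable1_continuous f :
  (forall x : R, derivable f x (1 : R)) -> continuous f.
Proof. by move=> df x; apply/differentiable_continuous/derivable1_diffP. Qed.

Lemma C1k_continuous k f : C1k k f -> continuous f.
Proof. by case: k => [|k] []. Qed.

Lemma C1kS k f g :
  (forall x : R, is_derive x (1 : R) f (g x)) -> C1k k g -> C1k k.+1 f.
Proof.
move=> fg gk; have df x : derivable f x 1 by have := fg x.
split; first exact: derivable1_continuous.
split=> //; suff -> : (derive1 f) = g by [].
by apply/funext => x; rewrite derive1E; have := fg x => fgx; rewrite derive_val.
Qed.

Lemma C1k_derive k f : C1k k.+1 f ->
  forall x : R, is_derive x (1:R) f (derive1 f x).
Proof. by move=> [_ [df _]] x; rewrite derive1E; exact: derivableP. Qed.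

Lemma C1kW k f : C1k k.+1 f -> C1k k f.
Proof.
elim: k f => [|k IH] f; first by move=> [].
by move=> [cf [df /IH]].
Qed.

Lemma C1k_cst k (c : R) : C1k k (cst c).
Proof.
elim: k c => [|k IH] c; first by split=> // x; exact: cvg_cst.
by apply: (C1kS (g := cst 0)).
Qed.

Lemma C1k_id k : C1k k (@id R).
Proof.
case: k => [|k]; first by split=> // x; exact: cvg_id.
by apply: (C1kS (g := cst 1)); exact: C1k_cst.
Qed.

Lemma C1kD k f g : C1k k f -> C1k k g -> C1k k (fun x => f x + g x).
Proof.
elim: k f g => [|k IH] f g fk gk.
  by split=> // x; apply: cvgD; [exact: fk.1|exact: gk.1].
apply: (C1kS (g := fun x => (derive1 f) x + (derive1 g) x)).
  move=> x; have df := C1k_derive fk x; have dg := C1k_derive gk x.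
  exact: (is_deriveD df dg).
by apply: IH; [exact: fk.2.2|exact: gk.2.2].
Qed.

Lemma C1kM k f g : C1k k f -> C1k k g -> C1k k (fun x => f x * g x).
Proof.
elim: k f g => [|k IH] f g fk gk.
  by split=> // x; apply: cvgM; [exact: fk.1|exact: gk.1].
apply: (C1kS (g := fun x => f x * (derive1 g) x + g x * derive1 f x)).
  move=> x; have df := C1k_derive fk x; have dg := C1k_derive gk x.
  exact: (is_deriveM df dg).
apply: C1kD; apply: IH;
  [exact: C1kW|exact: gk.2.2|exact: C1kW|exact: fk.2.2].
Qed.

Lemma C1kZ k (c : R) f : C1k k f -> C1k k (fun x => c * f x).
Proof. by move=> fk; apply: C1kM => //; exact: C1k_cst. Qed.

Lemma C1kB k f g : C1k k f -> C1k k g -> C1k k (fun x => f x - g x).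
Proof.
move=> fk gk; rewrite (_ : (fun x => _) = (fun x => f x + (-1) * g x)).
  by apply: C1kD => //; exact: C1kZ.
by apply/funext => x; rewrite mulN1r.
Qed.

Lemma C1kV k f : (forall x, f x != 0) -> C1k k f -> C1k k (fun x => (f x)^-1).
Proof.
move=> f0; elim: k => [|k IH] fk.
  by split=> // x; apply: cvgV => //; exact: fk.1.
apply: (C1kS (g := fun x => (-1) * ((f x)^-1 * (f x)^-1 * derive1 f x))).
  move=> x.
  have df := C1k_derive fk x.
  apply: DeriveDef; first exact: derivableV.
  rewrite deriveV // derive_val /GRing.scale /= mulN1r -mulNr; congr (_ * _).
  by rewrite -exprVn expr2.
have fk' := IH (C1kW fk).
by apply/C1kZ/C1kM; [exact: C1kM|exact: fk.2.2].
Qed.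

Lemma is_derive_affine (f : R -> R) (f' a b x : R) :
  is_derive (a * x + b) (1:R) f f' ->
  is_derive x (1:R) (fun t => f (a * t + b)) (a * f').
Proof.
move=> df.
have dg : is_derive x (1:R) (fun t => a * t + b) a.
  have da : is_derive x (1:R) (fun t => a * t) a.
    apply: (is_derive_eq (is_deriveZ (f := id) a _)).
    by rewrite /GRing.scale /= mulr1.
  apply: (is_derive_eq (is_deriveD da (is_derive_cst b x (1:R)))).
  by rewrite addr0.
by rewrite mulrC; apply: (@is_derive1_comp _ f (fun t => a * t + b)).
Qed.

Lemma C1k_affine k f (a b : R) : C1k k f -> C1k k (fun x => f (a * x + b)).
Proof.
elim: k f => [|k IH] f fk.
  split=> // x; apply: (@continuous_comp _ _ _ (fun x : R => a * x + b) f).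
    apply: cvgD; last exact: cvg_cst.
    by apply: cvgM; [exact: cvg_cst|exact: cvg_id].
  exact: fk.1.
apply: (C1kS (g := fun x => a * (derive1 f) (a * x + b))) => [x|].
  exact: (is_derive_affine (C1k_derive fk _)).
by apply/C1kZ/IH; exact: fk.2.2.
Qed.

(** Each monomial is dominated by one term of the exponential series; the
    bound is the resulting sum of factorials. *)
Lemma expR_dominates_poly (p : {poly R}) :
  exists C, forall y, 0 <= y -> `|p.[y]| * expR (- y) <= C.
Proof.
exists (\sum_(i < size p) `|p`_i| * i`!%:R) => y y0.
rewrite horner_coef.
apply: (@le_trans _ _ (\sum_(i < size p) `|p`_i| * (y ^+ i * expR (- y)))).
  apply: (@le_trans _ _ ((\sum_(i < size p) `|p`_i * y ^+ i|) * expR (- y))).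
    by rewrite ler_wpM2r ?expR_ge0 // ler_norm_sum.
  rewrite mulr_suml; apply: ler_sum => i _.
  by rewrite normrM normrX (ger0_norm y0) mulrA.
apply: ler_sum => i _; apply: ler_wpM2l => //.
rewrite expRN ler_pdivrMr ?expR_gt0 //.
case: (nat_of_ord i) => [|n].
  by rewrite expr0 fact0 mul1r -expR0 ler_expR.
have := expR_ge1Dxn n y0; set F := n.+1`!%:R => h.
have F0 : 0 < F :> R by rewrite ltr0n fact_gt0.
by rewrite mulrC -ler_pdivrMr //; apply: le_trans h; rewrite lerDr.
Qed.

Lemma is_derive0_quadratic (f : R -> R) (C : R) :
  (forall x, `|f x| <= C * x ^+ 2) -> is_derive (0:R) 1 f 0.
Proof.
move=> fC.
have f0 : f 0 = 0.
  by apply/eqP; rewrite -normr_le0; have := fC 0; rewrite expr0n mulr0.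
have C0 : 0 <= C by have := le_trans (normr_ge0 _) (fC 1); rewrite expr1n mulr1.
suff H : h^-1 *: (f (h *: 1 + 0) - f 0) @[h --> (0:R)^'] --> (0:R).
  have := cvg_lim _ H; rewrite /derive => lE.
  apply: DeriveDef; first by apply/cvg_ex; exists 0; exact: H.
  exact: lE.
apply/cvgr0Pnorm_le => e e0; near=> h.
have h0 : h != 0 by near: h; exact: nbhs_dnbhs_neq.
rewrite f0 subr0 addr0 /GRing.scale /= mulr1 normrM normfV.
rewrite ler_pdivrMl ?normr_gt0 //; apply: le_trans (fC _) _.
rewrite -(ger0_norm (sqr_ge0 h)) normrX expr2 mulrA [leRHS]mulrC.
rewrite ler_wpM2r //.
have : `|h| <= e / (C + 1).
  near: h; apply: dnbhs0_le; rewrite divr_gt0 // ltr_pwDr //.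
rewrite ler_pdivlMr; last by rewrite ltr_pwDr.
by apply: le_trans; rewrite mulrC ler_wpM2l // lerDl.
Unshelve. all: by end_near. Qed.

(** Smoothness of [exp (- 1 / x)], extended by 0, cannot be proved by induction
    on that function alone: the family with a polynomial factor in [1 / x] is
    what makes it stable under differentiation. *)
Definition flat (p : {poly R}) (x : R) : R :=
  if 0 < x then p.[x^-1] * expR (- x^-1) else 0.

(** With [y = x^-1], the chain rule gives the factor [- y^2]. At 0 the claim is
    that the derivative is 0, which holds because [flat p] is [O(x^2)]: the
    exponential absorbs the polynomial ['X^2 * p]. *)
Lemma is_derive_flat (p : {poly R}) (x : R) :
  is_derive x (1:R) (flat p) (flat ('X^2 * (p - p^`())) x).
Proof.
have [x0|x0|->] := ltgtP x 0.
- rewrite /flat (lt_gtF x0).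
  apply: (@near_eq_is_derive _ _ _ (cst 0 : R -> R) _ _ (1:R)).
  by near=> y; rewrite /= ifF //; apply/negbTE; rewrite -leNgt ltW //;
    near: y; exact: lt_nbhsl.
- rewrite {2}/flat x0.
  apply: (@near_eq_is_derive R R R (fun y => p.[y^-1] * expR (- y^-1)) _ _
    (1:R)).
    by near=> y; rewrite /flat ifT //; near: y; exact: lt_nbhsr.
  have dV : is_derive x (1:R) (fun y : R => y^-1) (- (x^-1 ^+ 2)).
    have dx : derivable (@id R) x 1 by exact: derivable_id.
    apply: DeriveDef; first by apply: (derivableV (f := id)); rewrite ?gt_eqF.
    rewrite (deriveV (f := id)) ?gt_eqF // derive_id /GRing.scale /= mulr1.
    by rewrite exprVn.
  have d1 : is_derive x (1:R) (fun y : R => p.[y^-1])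
      (p^`().[x^-1] * (- (x^-1 ^+ 2))).
    apply: (@is_derive1_comp _ (horner p) (fun t => t^-1)).
  have d2 : is_derive x (1:R) (fun y : R => expR (- y^-1))
      (expR (- x^-1) * (x^-1 ^+ 2)).
    apply: (@is_derive1_comp _ expR (fun t => - t^-1)).
    by apply: (is_derive_eq (is_deriveN dV)); rewrite opprK.
  apply: (is_derive_eq (is_deriveM d1 d2)).
  rewrite /GRing.scale /= hornerM hornerXn hornerD hornerN; ring.
- rewrite {2}/flat ltxx.
  have [C HC] := expR_dominates_poly ('X^2 * p).
  apply: (@is_derive0_quadratic _ C) => y; rewrite /flat.
  case: ifPn => y0; last first.
    rewrite normr0 mulr_ge0 ?sqr_ge0 //.
    by apply: le_trans (HC 0 (lexx _)); rewrite mulr_ge0 ?expR_ge0.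
  have yV0 : 0 <= y^-1 by rewrite invr_ge0 ltW.
  have := HC _ yV0.
  rewrite hornerM hornerXn normrM [`|y^-1 ^+ 2|]ger0_norm ?sqr_ge0 //.
  rewrite normrM [`|expR _|]ger0_norm ?expR_ge0 // => h.
  have := ler_wpM2r (sqr_ge0 y) h; apply: le_trans.
  by rewrite le_eqVlt; apply/orP; left; apply/eqP; field; rewrite gt_eqF.
Unshelve. all: by end_near. Qed.

Lemma smooth_flat p : smooth (flat p).
Proof.
move=> k; elim: k p => [|k IH] p.
  by split=> //; apply: derivable1_continuous => x; have := is_derive_flat p x.
by apply: C1kS; [exact: is_derive_flat|exact: IH].
Qed.

(** A smooth transition from 0 to 1 over the unit interval. Each of the two
    terms of the denominator vanishes only where the other one is positive. *)
Definition step (x : R) : R := flat 1 x / (flat 1 x + flat 1 (1 - x)).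

Lemma flat1_gt0 x : 0 < x -> 0 < flat 1 x.
Proof. by move=> x0; rewrite /flat x0 hornerC mul1r expR_gt0. Qed.

Lemma flat1_ge0 x : 0 <= flat 1 x.
Proof.
rewrite /flat; case: ifP => // _; by rewrite hornerC mul1r expR_ge0.
Qed.

Lemma flat1_eq0 x : x <= 0 -> flat 1 x = 0.
Proof. by move=> x0; rewrite /flat ltNge x0. Qed.

Lemma step_den_gt0 x : 0 < flat 1 x + flat 1 (1 - x).
Proof.
have [x0|x0] := ltP 0 x.
  by rewrite ltr_pwDl ?flat1_gt0 ?flat1_ge0.
rewrite ltr_wpDl ?flat1_ge0 // flat1_gt0 //; lra.
Qed.

Lemma smooth_step : smooth step.
Proof.
move=> k; apply: C1kM; first exact: smooth_flat.
apply: C1kV => [x|]; first by rewrite gt_eqF ?step_den_gt0.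
apply: C1kD; first exact: smooth_flat.
rewrite (_ : (fun x => _) = (fun x => flat 1 (-1 * x + 1))).
  by apply: C1k_affine; exact: smooth_flat.
by apply/funext => x; rewrite mulN1r addrC.
Qed.

Lemma step0 x : x <= 0 -> step x = 0.
Proof. by move=> x0; rewrite /step flat1_eq0 // mul0r. Qed.

Lemma step1 x : 1 <= x -> step x = 1.
Proof.
move=> x1; rewrite /step (@flat1_eq0 (1 - x)) ?subr_le0 // addr0 divff //.
by rewrite gt_eqF // flat1_gt0 // (lt_le_trans ltr01).
Qed.

End smooth.

(** * Ramps and test functions of product form *)

Section ramps.
Context {R : realType}.
Implicit Types (f g : R -> R) (k : nat).

Lemma smoothB f g : smooth f -> smooth g -> smooth (fun x => f x - g x).
Proof. by move=> sf sg k; exact: C1kB. Qed.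

Lemma smoothZ (c : R) f : smooth f -> smooth (fun x => c * f x).
Proof. by move=> sf k; exact: C1kZ. Qed.

Lemma smooth_derive1 f : smooth f -> smooth (derive1 f).
Proof. by move=> sf k; have [_ []] := sf k.+1. Qed.

Lemma smooth_is_derive f : smooth f ->
  forall x : R, is_derive x (1:R) f (derive1 f x).
Proof. by move=> /(_ 1%N)/C1k_derive. Qed.

(** Ramps of height 0 are the functions with support in the closed interval;
    the others serve as primitives of such functions, with [L] the integral of
    the derivative. *)
Definition ramp (a b L : R) f :=
  [/\ smooth f, forall x, x < a -> f x = 0 & forall x, b < x -> f x = L].

Lemma derive1_near_cst f (c x : R) : (\near x, f x = c) -> derive1 f x = 0.
Proof.
move=> fc; rewrite derive1E; have : is_derive x (1:R) f 0.
  apply: (@near_eq_is_derive R R R (cst c : R -> R) _ _ (1:R)).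
  by apply: filterS fc => y ->.
by move=> df; rewrite derive_val.
Qed.

Lemma ramp_derive1 a b L f : ramp a b L f -> ramp a b 0 (derive1 f).
Proof.
move=> [sf f0 fL]; split; first exact: smooth_derive1.
- move=> x xa; apply: (@derive1_near_cst _ 0); near=> y; apply: f0.
  by near: y; exact: lt_nbhsl.
- move=> x bx; apply: (@derive1_near_cst _ L); near=> y; apply: fL.
  by near: y; exact: lt_nbhsr.
Unshelve. all: by end_near. Qed.

Lemma rampB a b L K f g :
  ramp a b L f -> ramp a b K g -> ramp a b (L - K) (fun x => f x - g x).
Proof.
move=> [sf f0 fL] [sg g0 gK]; split; first exact: smoothB.
- by move=> x xa; rewrite f0 ?g0 ?subrr.
- by move=> x xa; rewrite fL ?gK.
Qed.

Lemma rampZ a b L c f : ramp a b L f -> ramp a b (c * L) (fun x => c * f x).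
Proof.
move=> [sf f0 fL]; split; first exact: smoothZ.
- by move=> x xa; rewrite f0 ?mulr0.
- by move=> x xa; rewrite fL.
Qed.

Lemma ramp_widen a b a' b' L f : a' <= a -> b <= b' ->
  ramp a b L f -> ramp a' b' L f.
Proof.
move=> aa bb [sf f0 fL]; split => // x xa.
- by apply: f0; exact: lt_le_trans aa.
- by apply: fL; exact: le_lt_trans xa.
Qed.

Lemma ramp_bounded a b L f : ramp a b L f -> exists M, forall x, `|f x| <= M.
Proof.
move=> [sf f0 fL].
have cf : {within `[a, b], continuous f}.
  by apply: continuous_subspaceT; exact: C1k_continuous (sf 0%N).
have := compact_bounded (continuous_compact cf (@segment_compact _ a b)).
move=> [M [Mr HM]]; exists (Num.max (`|M| + 1) `|L|) => x.
rewrite le_max; have [xa|ax] := ltP x a; first by rewrite f0 // normr0 addr_ge0.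
have [bx|xb] := ltP b x; first by rewrite fL // lexx orbT.
apply/orP; left; apply: (HM (`|M| + 1)).
  by rewrite (le_lt_trans (ler_norm _)) // ltrDl.
by exists x => //=; rewrite in_itv /= ax xb.
Qed.

Definition tensor f g : R * R -> R := fun x => f x.1 * g x.2.

Lemma partial1_tensor f g : smooth f ->
  partial1 (tensor f g) = tensor (derive1 f) g.
Proof.
move=> sf; apply/funext => -[x y]; rewrite /partial1 /tensor /= derive1Mr //.
by have := smooth_is_derive sf x.
Qed.

Lemma partial2_tensor f g : smooth g ->
  partial2 (tensor f g) = tensor f (derive1 g).
Proof.
move=> sg; apply/funext => -[x y]; rewrite /partial2 /tensor /= derive1Ml //.
by have := smooth_is_derive sg y.
Qed.

Lemma continuous_tensor f g : continuous f -> continuous g ->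
  continuous (tensor f g).
Proof.
move=> cf cg x; apply: cvgM.
- by apply: (@continuous_comp _ _ _ fst f); [exact: cvg_fst|exact: cf].
- by apply: (@continuous_comp _ _ _ snd g); [exact: cvg_snd|exact: cg].
Qed.

Lemma Ck_tensor k f g : smooth f -> smooth g -> Ck k (tensor f g).
Proof.
have ct f1 g1 : smooth f1 -> smooth g1 -> continuous (tensor f1 g1).
  by move=> sf sg; apply: continuous_tensor; apply: (@C1k_continuous _ 0%N).
elim: k f g => [|k IH] f g sf sg; split; try exact: ct; try by [].
split.
- move=> x; rewrite /tensor /=.
  have df := smooth_is_derive sf x.1.
  exact: (@ex_derive _ _ _ _ _ _ _
    (is_deriveM df (is_derive_cst (g x.2) x.1 (1:R)))).
- move=> x; rewrite /tensor /=.
  have dg := smooth_is_derive sg x.2.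
  exact: (@ex_derive _ _ _ _ _ _ _
    (is_deriveM (is_derive_cst (f x.1) x.2 (1:R)) dg)).
- by rewrite partial1_tensor //; apply: IH => //; exact: smooth_derive1.
- by rewrite partial2_tensor //; apply: IH => //; exact: smooth_derive1.
Qed.

Lemma test_function_tensor (Omega : set (R * R)) a b c d f g :
  ramp a b 0 f -> ramp c d 0 g -> `[a, b] `*` `[c, d] `<=` Omega ->
  test_function Omega (tensor f g).
Proof.
move=> [sf f0 f1] [sg g0 g1] sub; rewrite /test_function.
have ck : compact (`[a, b] `*` `[c, d] : set (R * R)).
  by apply: compact_setX; exact: segment_compact.
have sc : closure [set x | tensor f g x != 0] `<=` `[a, b] `*` `[c, d].
  have cl : closed (`[a, b] `*` `[c, d] : set (R * R)).
    apply: compact_closed ck.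
    exact: norm_hausdorff.
  rewrite [X in _ `<=` X](closure_id _).1 //; apply: closure_subset.
  move=> [x y]; rewrite /tensor /= mulf_eq0 negb_or => /andP[fx gy].
  split; rewrite /= in_itv /=; apply/andP; split;
    rewrite leNgt; apply/negP => h.
  - by rewrite f0 ?eqxx in fx.
  - by rewrite f1 ?eqxx in fx.
  - by rewrite g0 ?eqxx in gy.
  - by rewrite g1 ?eqxx in gy.
split.
- by move=> k; exact: Ck_tensor.
- by apply: subclosed_compact ck sc; exact: closed_closure.
- exact: subset_trans sc sub.
Qed.

(** A smooth version of the positive part, with an explicit formula. Its
    derivative is bounded and passes from 0 to 1, so that rescaled differences
    of this derivative approximate indicator functions of intervals while
    having known primitives. *)
Definition softpos (x : R) : R := x * step x.

Lemma smooth_softpos : smooth softpos.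
Proof. by move=> k; apply: C1kM; [exact: C1k_id|exact: smooth_step]. Qed.

Lemma softpos0 x : x <= 0 -> softpos x = 0.
Proof. by move=> x0; rewrite /softpos step0 ?mulr0. Qed.

Lemma softpos1 x : 1 <= x -> softpos x = x.
Proof. by move=> x0; rewrite /softpos step1 ?mulr1. Qed.

Lemma derive1_softpos_lt0 x : x < 0 -> derive1 softpos x = 0.
Proof.
move=> x0; apply: (@derive1_near_cst _ 0); near=> y; apply: softpos0.
by apply: ltW; near: y; exact: lt_nbhsl.
Unshelve. all: by end_near. Qed.

Lemma derive1_softpos_gt1 x : 1 < x -> derive1 softpos x = 1.
Proof.
move=> x1; rewrite derive1E.
have : is_derive x (1:R) softpos 1.
  apply: (@near_eq_is_derive R R R (@id R) _ _ (1:R)).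
  near=> y; rewrite softpos1 //.
  by apply: ltW; near: y; exact: lt_nbhsr.
by move=> df; rewrite derive_val.
Unshelve. all: by end_near. Qed.

Lemma derive1_softpos0 : derive1 softpos 0 = 0.
Proof.
have ds := smooth_is_derive smooth_step (0:R).
have := is_deriveM (is_derive_id (0:R) (1:R)) ds.
rewrite /GRing.scale /= mul0r add0r step0 // mul0r => dT.
by rewrite derive1E; exact: derive_val.
Qed.

Lemma ramp_softpos : ramp 0 1 1 (derive1 softpos).
Proof.
split; first exact/smooth_derive1/smooth_softpos.
- exact: derive1_softpos_lt0.
- exact: derive1_softpos_gt1.
Qed.

(** Up to smoothing at scale [1 / n.+1], this is the piecewise affine function
    that rises from 0 to [q - p] over the interval from [p] to [q]. *)
Definition indic_primitive (p q : R) (n : nat) (x : R) : R :=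
  n.+1%:R^-1 * (softpos (n.+1%:R * x + - (n.+1%:R * p)) -
                softpos (n.+1%:R * x + - (n.+1%:R * q))).

Definition indic_approx (p q : R) (n : nat) (x : R) : R :=
  derive1 softpos (n.+1%:R * (x - p)) - derive1 softpos (n.+1%:R * (x - q)).

Lemma smooth_indic_primitive p q n : smooth (indic_primitive p q n).
Proof.
by move=> k; apply/C1kZ/C1kB; apply: C1k_affine; exact: smooth_softpos.
Qed.

Lemma ramp_indic_primitive p q n : p <= q ->
  ramp p (q + n.+1%:R^-1) (q - p) (indic_primitive p q n).
Proof.
move=> pq; have n0 : 0 < n.+1%:R :> R by rewrite ltr0n.
split.
- exact: smooth_indic_primitive.
- move=> x xp; rewrite /indic_primitive !softpos0 ?subrr ?mulr0 //.
  + by rewrite subr_le0 ler_pM2l // ltW // (lt_le_trans xp).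
  + by rewrite subr_le0 ler_pM2l // ltW.
- move=> x qx.
  have h : 1 <= n.+1%:R * x - n.+1%:R * q.
    by rewrite -mulrBr -ler_pdivrMl // mulr1 lerBrDl ltW.
  rewrite /indic_primitive !softpos1 //.
    field; by rewrite gt_eqF.
  by apply: le_trans h _; rewrite lerD2l lerN2 ler_pM2l.
Qed.

Lemma derive1_indic_primitive p q n :
  derive1 (indic_primitive p q n) = indic_approx p q n.
Proof.
have n0 : n.+1%:R != 0 :> R by rewrite pnatr_eq0.
apply/funext => x.
have d y := is_derive_affine
  (smooth_is_derive smooth_softpos (n.+1%:R * x + - (n.+1%:R * y))).
have := is_deriveZ (n.+1%:R^-1) (is_deriveB (d p) (d q)) => dT.
rewrite derive1E (@derive_val _ _ _ _ _ _ _ dT).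
rewrite /indic_approx /GRing.scale /= !mulrBr.
by rewrite !mulKf.
Qed.

(** Where the limit is constant, so is the sequence from some rank on. The
    interval is open at [p] and closed at [q] because the derivative of
    [softpos] vanishes at 0. *)
Lemma indic_approx_cvg p q x : p <= q ->
  indic_approx p q n x @[n --> \oo] --> (\1_`]p, q] x : R).
Proof.
move=> pq.
have big y : y < x ->
    \forall n \near \oo, derive1 softpos (n.+1%:R * (x - y)) = 1.
  move=> yx; have xy0 : 0 < x - y by rewrite subr_gt0.
  near=> n; apply: derive1_softpos_gt1; rewrite -ltr_pdivrMr //.
  apply: (@lt_trans _ _ n%:R); last by rewrite ltr_nat.
  by near: n; exact: nbhs_infty_gtr.
have small n y : x <= y -> derive1 softpos (n.+1%:R * (x - y)) = 0.
  rewrite -subr_le0 le_eqVlt => /orP[/eqP->|h].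
    by rewrite mulr0 derive1_softpos0.
  by apply: derive1_softpos_lt0; rewrite pmulr_rlt0 // ltr0n.
apply: cvg_near_cst; rewrite indicE mem_setE in_itv /=.
have [xp|px] := leP x p.
  by near=> n; rewrite /indic_approx !small ?subrr // (le_trans xp).
have [xq|qx] := leP x q.
  near=> n; rewrite /indic_approx (small _ q) // subr0.
  by near: n; exact: big.
have := big _ px; have := big _ qx.
by apply: filterS2 => n h1 h2; rewrite /indic_approx h1 h2 subrr.
Unshelve. all: by end_near. Qed.

Lemma indic_approx_bounded :
  exists M, forall p q n x, `|indic_approx p q n x| <= M.
Proof.
have [M HM] := ramp_bounded ramp_softpos; exists (M + M) => p q n x.
by apply: le_trans (ler_normB _ _) _; exact: lerD.
Qed.

Lemma ex_unit_ramp a b : a < b -> exists s, ramp a b 1 s.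
Proof.
move=> ab; have c0 : 0 < b - a by rewrite subr_gt0.
exists (fun x => step ((b - a)^-1 * x + (- ((b - a)^-1 * a)))); split.
- by move=> k; apply: C1k_affine; exact: smooth_step.
- by move=> x xa; rewrite step0 // -mulrBr pmulr_rle0 ?invr_gt0 // subr_le0 ltW.
- by move=> x xb; rewrite step1 // -mulrBr ler_pdivlMl // mulr1 lerD2r ltW.
Qed.

End ramps.

(** * Integrals over rectangles when the distributional gradient vanishes *)

Section vanishing_integrals.
Local Open Scope ereal_scope.
Context d d' (T : measurableType d) (T' : measurableType d') (R : realType).
Variables (mu : {measure set T -> \bar R}) (v : T -> \bar R).
Hypothesis iv : mu.-integrable setT v.

(** The pi-lambda theorem for a signed density: the sets over which the
    integral is 0 form a lambda-system once the whole of [X] is one of them.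
    The map [h] allows for inducting on one factor of a product at a time. *)
Lemma integral0_induction (h : T -> T') (X : set T) (G : set (set T')) :
  measurable_fun setT h -> measurable X ->
  @measurable _ T' = <<s G >> -> setI_closed G ->
  \int[mu]_(x in X) v x = 0 ->
  (forall A, G A -> \int[mu]_(x in X `&` h @^-1` A) v x = 0) ->
  forall A, measurable A -> \int[mu]_(x in X `&` h @^-1` A) v x = 0.
Proof.
move=> mh mX mG GI vX vG A; rewrite mG.
have mXh B : measurable B -> measurable (X `&` h @^-1` B).
  by move=> mB; apply: measurableI => //; rewrite -[_ @^-1` _]setTI; exact: mh.
have ivS Y : measurable Y -> mu.-integrable Y v.
  by move=> mY; apply: integrableS iv.
move: A; apply: dynkin_induction => //.
- by rewrite preimage_setT setIT.
- move=> S mS vS.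
  have : \int[mu]_(x in (X `&` h @^-1` S) `|` (X `&` h @^-1` (~` S))) v x = 0.
    by rewrite -setIUr preimage_setC setUv setIT.
  rewrite integral_setU //; first by rewrite vS add0e.
  + exact: mXh.
  + by apply: mXh; exact: measurableC.
  + apply: measurable_funS (measurable_int _ iv) => //.
  + by apply/disj_setPS => x /= [[_ Sx] [_ /(_ Sx)]].
- move=> F mF tF vF; rewrite preimage_bigcup setI_bigcupr integral_bigcup.
  + by apply: eseries0 => n _ _; exact: vF.
  + apply/trivIsetP => i j _ _ ij; rewrite -subset0 => x [[_ Fi] [_ Fj]].
    move/trivIsetP : tF => /(_ i j I I ij).
    by rewrite -subset0 => /(_ (h x)); apply.
  + by move=> n; exact: mXh.
  + by apply: ivS; apply: bigcup_measurable => n _; exact: mXh.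
Qed.

End vanishing_integrals.

Section plane.
Context {R : realType}.
Implicit Types (f g : R -> R) (w : plane R -> R).
Local Notation mu := (@leb2 R).

Lemma measurable_tensor f g :
  measurable_fun setT f -> measurable_fun setT g ->
  measurable_fun (setT : set (plane R)) (tensor f g).
Proof.
move=> mf mg; apply: measurable_funM.
- by apply: (measurableT_comp mf); exact: measurable_fst.
- by apply: (measurableT_comp mg); exact: measurable_snd.
Qed.

Lemma smooth_measurable f : smooth f -> measurable_fun setT f.
Proof.
move=> sf; apply: continuous_measurable_fun.
exact: C1k_continuous (sf 0%N).
Qed.

Lemma tensor_bounded f g M N :
  (forall x, `|f x| <= M) -> (forall x, `|g x| <= N) ->
  forall x, `|tensor f g x| <= M * N.
Proof. by move=> fM gN x; rewrite normrM ler_pM. Qed.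

Lemma integrable_mul_bounded w (phi : plane R -> R) M :
  mu.-integrable setT (EFin \o w) -> measurable_fun setT phi ->
  (forall x, `|phi x| <= M) ->
  mu.-integrable setT (EFin \o (fun x => w x * phi x)).
Proof.
move=> iw mphi phiM.
apply: (@eq_integrable _ _ _ _ _ _ ((EFin \o w) \* (EFin \o phi))%E) => //.
apply: integrableMl => //.
exists M; split; first exact: num_real.
by move=> K MK x _ /=; apply: le_trans (phiM x) _; exact: ltW.
Qed.

Definition pairing w (phi : plane R -> R) : \bar R :=
  (\int[mu]_x (w x * phi x)%:E)%E.

Lemma pairing_proportional w (phi psi : plane R -> R) (L : R) :
  mu.-integrable setT (EFin \o (fun x => w x * phi x)) ->
  mu.-integrable setT (EFin \o (fun x => w x * psi x)) ->
  pairing w (fun x => phi x - L * psi x) = 0%E ->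
  pairing w phi = (L%:E * pairing w psi)%E.
Proof.
move=> i1 i2.
have := integralB measurableT i1 (integrableZl measurableT L i2).
rewrite (integralZl measurableT i2) => E.
rewrite /pairing (_ : (fun x => _) =
  (fun x => (w x * phi x)%:E - L%:E * (w x * psi x)%:E)%E).
  rewrite E => /eqP; rewrite sube_eq ?add0e => [/eqP//||].
    exact: integrable_fin_num.
  by rewrite fin_num_adde_defl // fin_numM // integrable_fin_num.
by apply/funext => x; rewrite -EFinM -EFinB; congr EFin; ring.
Qed.

Lemma ramp0_tensor_bounded a b c e f g : ramp a b 0 f -> ramp c e 0 g ->
  exists M, forall x, `|tensor f g x| <= M.
Proof.
move=> /ramp_bounded[M fM] /ramp_bounded[N gN].
by exists (M * N); exact: tensor_bounded.
Qed.

Lemma integrable_mul_ramps w a b c e f g : mu.-integrable setT (EFin \o w) ->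
  ramp a b 0 f -> ramp c e 0 g ->
  mu.-integrable setT (EFin \o (fun x => w x * tensor f g x)).
Proof.
move=> iw rf rg; have [M HM] := ramp0_tensor_bounded rf rg.
have [sf _ _] := rf; have [sg _ _] := rg.
apply: (integrable_mul_bounded iw _ HM).
by apply: measurable_tensor; exact: smooth_measurable.
Qed.

Section zero_gradient.
Variables (Omega : set (R * R)) (w : plane R -> R).
Hypothesis iw : mu.-integrable setT (EFin \o w).
Hypothesis w1 : forall phi, test_function Omega phi ->
  pairing w (partial1 phi) = 0%E.
Hypothesis w2 : forall phi, test_function Omega phi ->
  pairing w (partial2 phi) = 0%E.

(** [F - L s] has height 0, hence gives a test function: up to the factor [L],
    the pairing with the derivative of [F] does not see [F]. *)
Lemma pairing_ramp1 a b c e L F s g :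
  `[a, b] `*` `[c, e] `<=` Omega ->
  ramp a b L F -> ramp a b 1 s -> ramp c e 0 g ->
  pairing w (tensor (derive1 F) g) =
  (L%:E * pairing w (tensor (derive1 s) g))%E.
Proof.
move=> sub rF rs rg.
have rFs : ramp a b 0 (fun x => F x - L * s x).
  by have := rampB rF (rampZ L rs); rewrite mulr1 subrr.
have := w1 (test_function_tensor rFs rg sub).
have [sF _ _] := rF; have [ss _ _] := rs; have [sFs _ _] := rFs.
rewrite partial1_tensor // => H0.
have dE : derive1 (fun x => F x - L * s x) =
    (fun x => derive1 F x - L * derive1 s x).
  apply/funext => x; rewrite derive1E.
  have H := is_deriveB (smooth_is_derive sF x)
    (is_deriveZ L (smooth_is_derive ss x)).
  exact: (@derive_val _ _ _ _ _ _ _ H).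
apply: pairing_proportional.
- exact: (integrable_mul_ramps iw (ramp_derive1 rF) rg).
- exact: (integrable_mul_ramps iw (ramp_derive1 rs) rg).
- rewrite -[RHS]H0; congr (pairing w _); apply/funext => x.
  by rewrite dE /tensor; ring.
Qed.

Lemma pairing_ramp2 a b c e L F s f :
  `[a, b] `*` `[c, e] `<=` Omega ->
  ramp c e L F -> ramp c e 1 s -> ramp a b 0 f ->
  pairing w (tensor f (derive1 F)) =
  (L%:E * pairing w (tensor f (derive1 s)))%E.
Proof.
move=> sub rF rs rf.
have rFs : ramp c e 0 (fun x => F x - L * s x).
  by have := rampB rF (rampZ L rs); rewrite mulr1 subrr.
have := w2 (test_function_tensor rf rFs sub).
have [sF _ _] := rF; have [ss _ _] := rs; have [sFs _ _] := rFs.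
rewrite partial2_tensor // => H0.
have dE : derive1 (fun x => F x - L * s x) =
    (fun x => derive1 F x - L * derive1 s x).
  apply/funext => x; rewrite derive1E.
  have H := is_deriveB (smooth_is_derive sF x)
    (is_deriveZ L (smooth_is_derive ss x)).
  exact: (@derive_val _ _ _ _ _ _ _ H).
apply: pairing_proportional.
- exact: (integrable_mul_ramps iw rf (ramp_derive1 rF)).
- exact: (integrable_mul_ramps iw rf (ramp_derive1 rs)).
- rewrite -[RHS]H0; congr (pairing w _); apply/funext => x.
  by rewrite dE /tensor; ring.
Qed.

(** The constant [k] is the pairing with the product of two fixed bumps of mass
    one. The upper ends are kept away from [b] and [e] because the approximations
    of indicator functions overflow by [n.+1%:R^-1] on the right. *)
Lemma pairing_rectangle a b c e : a < b -> c < e ->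
  `[a, b] `*` `[c, e] `<=` Omega ->
  exists k : R, forall p1 p2 q1 q2, a <= p1 -> p1 <= p2 -> p2 < b ->
    c <= q1 -> q1 <= q2 -> q2 < e ->
    (\int[mu]_(x in `]p1, p2] `*` `]q1, q2]) (w x)%:E =
     (k * ((p2 - p1) * (q2 - q1)))%:E)%E.
Proof.
move=> ab ce sub.
have [s rs] := ex_unit_ramp ab; have [t rt] := ex_unit_ramp ce.
pose kE := pairing w (tensor (derive1 s) (derive1 t)).
have kfin : kE \is a fin_num.
  apply: integrable_fin_num => //.
  exact: integrable_mul_ramps iw (ramp_derive1 rs) (ramp_derive1 rt).
exists (fine kE) => p1 p2 q1 q2 ap1 p12 p2b cq1 q12 q2e.
have approx : \forall n \near \oo,
    pairing w (tensor (indic_approx p1 p2 n) (indic_approx q1 q2 n)) =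
    (fine kE * ((p2 - p1) * (q2 - q1)))%:E.
  have near_lt (p b' : R) : p < b' -> \forall n \near \oo, p + n.+1%:R^-1 < b'.
    move=> pb; have d0 : 0 < b' - p by rewrite subr_gt0.
    near=> n; rewrite -ltrBrDl.
    by near: n; exact: (near_infty_natSinv_lt (PosNum d0)).
  near=> n.
  have rF : ramp a b (p2 - p1) (indic_primitive p1 p2 n).
    apply: ramp_widen (ramp_indic_primitive n p12) => //.
    by apply: ltW; near: n; exact: near_lt.
  have rG : ramp c e (q2 - q1) (indic_primitive q1 q2 n).
    apply: ramp_widen (ramp_indic_primitive n q12) => //.
    by apply: ltW; near: n; exact: near_lt.
  rewrite -!derive1_indic_primitive (pairing_ramp1 sub rF rs (ramp_derive1 rG)).
  rewrite (pairing_ramp2 sub rG rt (ramp_derive1 rs)) -/kE.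
  by rewrite -(fineK kfin) -!EFinM; congr EFin; rewrite /=; ring.
have [M HM] := @indic_approx_bounded R.
pose I := (\1_`]p1, p2] : R -> R); pose J := (\1_`]q1, q2] : R -> R).
have mI : measurable_fun setT I by exact: measurable_indic.
have mJ : measurable_fun setT J by exact: measurable_indic.
have mm p q n : measurable_fun setT (@indic_approx R p q n).
  apply: smooth_measurable; rewrite -derive1_indic_primitive.
  by apply: smooth_derive1; exact: smooth_indic_primitive.
have mw : measurable_fun setT w.
  by apply/measurable_EFinP; exact: measurable_int iw.
pose fn n (x : plane R) :=
  (w x * tensor (indic_approx p1 p2 n) (indic_approx q1 q2 n) x)%:E.
pose f0 (x : plane R) := (w x * tensor I J x)%:E.
have mfn n : measurable_fun setT (fn n).
  by apply/measurable_EFinP/measurable_funM => //; exact: measurable_tensor.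
have mf0 : measurable_fun setT f0.
  by apply/measurable_EFinP/measurable_funM => //; exact: measurable_tensor.
have fnf0 : {ae mu, forall x, setT x -> fn ^~ x @ \oo --> f0 x}.
  apply: aeW => x _; apply: cvg_EFin; first exact: nearW.
  apply: cvgM; first exact: cvg_cst.
  by apply: cvgM; exact: indic_approx_cvg.
have fnM : {ae mu, forall x n, setT x ->
    (`|fn n x| <= (M * M)%:E * `|(w x)%:E|)%E}.
  apply: aeW => x n _; rewrite /fn EFinM abseM muleC lee_wpmul2r //.
  by rewrite abse_EFin lee_fin tensor_bounded.
have iM : mu.-integrable setT (fun x => (M * M)%:E * `|(w x)%:E|)%E.
  by apply: integrableZl => //; exact: integrable_abse.
have [_ _ DC] := dominated_convergence measurableT mfn mf0 fnf0 iM fnM.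
have DC' : (\int[mu]_x fn n x)%E @[n --> \oo] -->
    (fine kE * ((p2 - p1) * (q2 - q1)))%:E.
  by apply: cvg_near_cst.
rewrite -(cvg_lim _ DC') //; rewrite (cvg_lim _ DC) //.
rewrite [LHS]integral_mkcond; apply: eq_integral => -[x y] _.
rewrite /f0 /tensor /I /J patchE !indicE in_setX /=.
by do 2 case: (_ \in _); rewrite /= ?mulr1 ?mulr0 ?mul0r ?mulr0.
Unshelve. all: by end_near. Qed.

End zero_gradient.
End plane.

(** * From rectangles to almost every point *)

Section local.
Context {R : realType}.
Implicit Types (w : plane R -> R).
Local Notation mu := (@leb2 R).
Local Notation itv a b := (`]a, b]%classic : set (measurableTypeR R)).

Lemma leb2X (A B : set (measurableTypeR R)) : measurable A -> measurable B ->
  mu (A `*` B) = (lebesgue_measure A * lebesgue_measure B)%E.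
Proof. by move=> mA mB; exact: product_measure1E. Qed.

Lemma leb2_rect (a b c e : R) : a <= b -> c <= e ->
  mu (itv a b `*` itv c e) = ((b - a) * (e - c))%:E.
Proof.
move=> ab ce; rewrite leb2X //.
rewrite !lebesgue_measure_itv /= !lte_fin EFinM.
have h (x y : R) : x <= y ->
    (if (x < y)%R then y%:E - x%:E else 0)%E = (y - x)%:E.
  by rewrite le_eqVlt => /orP[/eqP->|->//]; rewrite ltxx subrr.
by rewrite !h.
Qed.

Lemma itv_sub_cap (a b : R) (A : set (measurableTypeR R)) : ocitv A ->
  A `&` itv a b = set0 \/
  exists p q, [/\ a <= p, p <= q, q <= b & A `&` itv a b = itv p q].
Proof.
move=> [[p q] _ <-] /=.
have [h|h] := leP (Num.min q b) (Num.max p a).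
  left; rewrite -subset0 => x [] /=.
  rewrite !in_itv /= => /andP[px xq] /andP[ax xb].
  have : Num.max p a < Num.min q b.
    by apply: (@lt_le_trans _ _ x); rewrite ?gt_max ?le_min ?px ?ax ?xq ?xb.
  by rewrite ltNge h.
right; exists (Num.max p a), (Num.min q b); split.
- by rewrite le_max lexx orbT.
- exact: ltW.
- by rewrite ge_min lexx orbT.
- apply/seteqP; split=> x /=; rewrite !in_itv /= gt_max le_min.
    by move=> [/andP[-> ->] /andP[-> ->]].
  by move=> /andP[/andP[-> ->] /andP[-> ->]].
Qed.

(** The density [w - k], cut off outside the rectangle, has integral 0 over
    half-open subrectangles, hence over all Borel sets by three successive
    inductions: on the first side, on the second side, and from measurable
    rectangles to the product sigma-algebra. *)
Lemma ae_cst_of_rectangles w k (a b c e : R) :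
  mu.-integrable setT (EFin \o w) -> a <= b -> c <= e ->
  (forall p1 p2 q1 q2, a <= p1 -> p1 <= p2 -> p2 <= b ->
    c <= q1 -> q1 <= q2 -> q2 <= e ->
    (\int[mu]_(x in itv p1 p2 `*` itv q1 q2) (w x)%:E =
     (k * ((p2 - p1) * (q2 - q1)))%:E)%E) ->
  ae_eq_on (itv a b `*` itv c e) w (cst k).
Proof.
move=> iw ab ce wk; set D := _ `*` _.
have mI p q : measurable (itv p q) by exact: measurable_itv.
have mD : measurable D by exact: measurableX.
have muD : (mu D < +oo)%E by rewrite /D leb2_rect // ltry.
pose f (x : plane R) := (w x - k)%:E.
have ic (A : set (plane R)) : measurable A -> A `<=` D ->
    mu.-integrable A (cst k%:E).
  move=> mA AD; apply/integrableP; split; first exact: measurable_cst.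
  rewrite integral_cst // lte_mul_pinfty //.
  by apply: le_lt_trans (le_measure _ _ _ AD) muD; rewrite inE.
have iwS (A : set (plane R)) : measurable A -> mu.-integrable A (EFin \o w).
  by move=> mA; apply: integrableS iw.
have ifS (A : set (plane R)) : measurable A -> A `<=` D -> mu.-integrable A f.
  by move=> mA AD; apply: (integrableB mA (iwS A mA) (ic A mA AD)).
pose v := f \_ D.
have iv : mu.-integrable setT v.
  by apply/integrable_restrict => //; rewrite setTI; exact: ifS.
have vD A : (\int[mu]_(x in A) v x = \int[mu]_(x in A `&` D) f x)%E.
  by rewrite integral_mkcondr.
have base p1 p2 q1 q2 : a <= p1 -> p1 <= p2 -> p2 <= b ->
    c <= q1 -> q1 <= q2 -> q2 <= e ->
    (\int[mu]_(x in itv p1 p2 `*` itv q1 q2) f x = 0)%E.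
  move=> ap p12 pb cq q12 qe.
  have sD : itv p1 p2 `*` itv q1 q2 `<=` D.
    move=> [x y] [] /=; rewrite !in_itv /= => /andP[px xp] /andP[qy yq].
    rewrite /D /=; rewrite !in_itv /= (le_lt_trans ap px) (le_trans xp pb).
    by rewrite (le_lt_trans cq qy) (le_trans yq qe).
  have mX : measurable (itv p1 p2 `*` itv q1 q2) by exact: measurableX.
  have -> : (\int[mu]_(x in itv p1 p2 `*` itv q1 q2) f x =
     \int[mu]_(x in itv p1 p2 `*` itv q1 q2)
       ((EFin \o w) \- cst k%:E) x)%E by [].
  rewrite integralB //; [|exact: iwS|exact: ic].
  by rewrite wk // integral_cst // leb2_rect // -EFinM subee.
pose good (A : set (measurableTypeR R)) p q := A `&` itv p q = set0 \/
  exists p' q', [/\ p <= p', p' <= q', q' <= q & A `&` itv p q = itv p' q'].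
(* [setT] is not a half-open interval, but its trace on a side of [D] is: this
   is what starts the inductions. *)
have goodT p q : p <= q -> good setT p q.
  by move=> pq; right; exists p, q; rewrite setTI.
have rect A B : good A a b -> good B c e ->
    (\int[mu]_(x in (fst @^-1` A `&` snd @^-1` B : set (plane R))) v x = 0)%E.
  move=> gA gB; rewrite vD.
  have -> : fst @^-1` A `&` snd @^-1` B `&` D =
      (A `&` itv a b) `*` (B `&` itv c e) :> set (plane R).
    by rewrite /D -setXI.
  case: gA => [->|[p [p' [ap pp pb ->]]]]; first by rewrite set0X integral_set0.
  case: gB => [->|[q [q' [cq qq qe ->]]]]; first by rewrite setX0 integral_set0.
  exact: base.
have mT : @measurable _ (measurableTypeR R) = <<s @ocitv R >> by [].
have mfst (A : set (measurableTypeR R)) : measurable A ->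
    measurable (fst @^-1` A : set (plane R)).
  by move=> mA; rewrite -[_ @^-1` _]setTI; exact: measurable_fst.
have msnd (A : set (measurableTypeR R)) : measurable A ->
    measurable (snd @^-1` A : set (plane R)).
  by move=> mA; rewrite -[_ @^-1` _]setTI; exact: measurable_snd.
have oc (A : set (measurableTypeR R)) : ocitv A -> measurable A.
  by move=> oA; rewrite mT; exact: sub_sigma_algebra.
have strip B : measurable B -> good B c e -> forall A, measurable A ->
    (\int[mu]_(x in (fst @^-1` A `&` snd @^-1` B : set (plane R))) v x = 0)%E.
  move=> mB gB A mA; rewrite setIC.
  apply: (integral0_induction iv (h := fst) (G := @ocitv R)) => //.
  - exact: msnd.
  - exact: ocitvI.
  - have := rect _ _ (goodT _ _ ab) gB; by rewrite preimage_setT setTI.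
  - by move=> I oI; rewrite setIC; apply: rect => //; exact: itv_sub_cap.
have box A B : measurable A -> measurable B ->
    (\int[mu]_(x in A `*` B) v x = 0)%E.
  move=> mA mB; rewrite (_ : A `*` B = fst @^-1` A `&` snd @^-1` B) //.
  apply: (integral0_induction iv (h := snd) (G := @ocitv R)) => //.
  - exact: mfst.
  - exact: ocitvI.
  - have := strip _ measurableT (goodT _ _ ce) _ mA.
    by rewrite preimage_setT setIT.
  - by move=> I oI; apply: strip => //; [exact: oc|exact: itv_sub_cap].
have all0 A : measurable A -> (\int[mu]_(x in A) v x = 0)%E.
  move=> mA; rewrite -[A]setTI.
  apply: (integral0_induction iv (h := id) (X := setT)
    (G := [set X `*` Y | X in measurable & Y in measurable])) => //.
  - exact: measurable_prod_measurableType.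
  - move=> _ _ [X1 mX1 [Y1 mY1 <-]] [X2 mX2 [Y2 mY2 <-]].
    rewrite -setXI; exists (X1 `&` X2); first exact: measurableI.
    by exists (Y1 `&` Y2) => //; exact: measurableI.
  - by rewrite -setXTT; exact: box.
  - by move=> _ [X mX [Y mY <-]]; rewrite setTI; exact: box.
have f0 : ae_eq mu D f (cst 0%E).
  apply: (integral_ae_eq mD (ifS D mD (@subset_refl _ D))).
    exact: measurable_cst.
  by move=> A AD mA; rewrite integral0 -(setIidl AD) -vD; exact: all0.
apply: filterS f0 => x /= fx Dx; have := fx Dx.
by rewrite /f => -[/eqP]; rewrite subr_eq0 => /eqP.
Qed.

End local.

(** * Open sets of the plane and gluing by connectedness *)

Section global.
Context {R : realType}.
Implicit Types (w : plane R -> R) (A U N : set (R * R)).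
Local Notation mu := (@leb2 R).

Definition square (p q r : R) : set (R * R) :=
  `]p - r, p + r[ `*` `]q - r, q + r[.

(** A countable base of open squares, enumerated by natural numbers so that
    countable unions apply directly. *)
Definition rat_square (n : nat) : set (R * R) :=
  if unpickle n is Some (p, q, r) then square (ratr p) (ratr q) (ratr (r : rat))
  else set0.

Lemma open_square p q r : open (square p q r).
Proof.
rewrite (_ : square p q r =
  fst @^-1` `]p - r, p + r[ `&` snd @^-1` `]q - r, q + r[) //.
apply: openI; apply: open_comp; try exact: interval_open.
- by move=> x _; exact: cvg_fst.
- by move=> x _; exact: cvg_snd.
Qed.

Lemma square_ball (x : R * R) e : square x.1 x.2 e `<=` ball x e.
Proof.
move=> y [] /=; rewrite !in_itv /= => /andP[h1 h2] /andP[h3 h4].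
by split; rewrite /ball /= distrC ltr_distl ?h1 ?h2 ?h3 ?h4.
Qed.

Lemma rat_square_basis U (x : R * R) : open U -> U x ->
  exists n, [/\ rat_square n x, rat_square n `<=` U &
    (0 < mu (rat_square n))%E].
Proof.
move=> oU Ux; have /nbhs_ballP[e /= e0 eU] : nbhs x U by exact: open_nbhs_nbhs.
have e2 : 0 < e / 2 by rewrite divr_gt0.
have [r] := rat_in_itvoo e2; rewrite in_itv /= => /andP[r0 re].
have hr (t : R) : t - ratr r < t + ratr r by lra.
have [p] := rat_in_itvoo (hr x.1); rewrite in_itv /= => /andP[p1 p2].
have [q] := rat_in_itvoo (hr x.2); rewrite in_itv /= => /andP[q1 q2].
exists (pickle (p, q, r)); rewrite /rat_square pickleK; split.
- by split; rewrite /= in_itv /=; apply/andP; split; lra.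
- move=> y [] /=; rewrite !in_itv /= => /andP[h1 h2] /andP[h3 h4].
  apply/eU/square_ball; split; rewrite /= in_itv /=; apply/andP; split; lra.
- rewrite /square leb2X // !lebesgue_measure_itv /= !lte_fin !ifT ?hr //.
  by rewrite -!EFinB -EFinM lte_fin mulr_gt0 //; lra.
Qed.

Lemma measurable_rat_square n : measurable (rat_square n : set (plane R)).
Proof.
rewrite /rat_square; case: unpickle => [[[p q] r]|] //.
by apply: measurableX; exact: measurable_itv.
Qed.

Lemma open_bigcup_rat_square U : open U ->
  U = \bigcup_(n in [set n | rat_square n `<=` U]) rat_square n.
Proof.
move=> oU; apply/seteqP; split=> [x Ux|x [n nU]]; last exact: nU.
by have [n [nx nU _]] := rat_square_basis oU Ux; exists n.
Qed.

Lemma open_measurable2 U : open U -> measurable (U : set (plane R)).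
Proof.
move=> /open_bigcup_rat_square ->; apply: bigcup_measurable => n _.
exact: measurable_rat_square.
Qed.

Lemma open_leb2_gt0 U : open U -> U !=set0 -> (0 < mu U)%E.
Proof.
move=> oU [x Ux]; have [n [_ nU n0]] := rat_square_basis oU Ux.
apply: lt_le_trans n0 _; apply: le_measure => //.
  by rewrite inE; exact: measurable_rat_square.
by rewrite inE; exact: open_measurable2.
Qed.

(** A Lindelof argument: the rational squares that meet [N] in a negligible
    set already cover [A]. *)
Lemma negligible_locally A (N : set (plane R)) :
  (forall x, A x -> exists U, [/\ open U, U x & mu.-negligible (U `&` N)]) ->
  mu.-negligible (A `&` N).
Proof.
move=> AU.
pose G n := if pselect (mu.-negligible (rat_square n `&` N))
  then rat_square n `&` N else set0.
apply: (@negligibleS _ _ _ mu (\bigcup_n G n) (A `&` N)); last first.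
  apply: negligible_bigcup => n; rewrite /G.
  case: pselect => [//|nN]; exact: negligible_set0.
move=> x [Ax Nx]; have [U [oU Ux UN]] := AU x Ax.
have [n [nx nU _]] := rat_square_basis oU Ux; exists n => //.
rewrite /G; case: pselect => [nN //|[]]; apply: negligibleS UN.
exact: setSI.
Qed.

Lemma ae_eq_on_negligible U w k :
  ae_eq_on U w (cst k) <-> mu.-negligible (U `&` [set x | w x != k]).
Proof.
rewrite /ae_eq_on /almost_everywhere /prop_near1 /nbhs /=.
suff -> : U `&` [set x | w x != k] = ~` [set x | U x -> w x = k] by [].
apply/seteqP; split => x /=.
  by move=> [Ux /eqP wk] /(_ Ux).
by move=> /not_implyP[Ux /eqP wk].
Qed.

Definition ae_const_open U w k := open U /\ ae_eq_on U w (cst k).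

Lemma ae_const_open_uniq U U' w k k' :
  ae_const_open U w k -> ae_const_open U' w k' ->
  U `&` U' !=set0 -> k = k'.
Proof.
move=> [oU wk] [oU' wk'] UU'; apply: contrapT => kk'.
have oI : open (U `&` U') by exact: openI.
have := open_leb2_gt0 oI UU'.
suff -> : mu (U `&` U') = 0%E by rewrite ltxx.
apply/negligibleP; first exact: open_measurable2.
move: wk wk' => /ae_eq_on_negligible n1 /ae_eq_on_negligible n2.
apply: negligibleS (negligibleU n1 n2) => x [Ux U'x].
have [wx|wx] := eqVneq (w x) k; last by left.
by right; split => //=; rewrite wx; apply/eqP.
Qed.

(** The points having a neighbourhood with constant [k0] form an open subset of
    [Omega]; its complement in [Omega] is the union of the open sets carrying
    another constant, so connectedness leaves no room for the latter. *)
Lemma ae_const_connected (Omega : set (R * R)) w : connected Omega ->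
  (forall x, Omega x -> exists U k, U x /\ ae_const_open U w k) ->
  exists k, ae_eq_on Omega w (cst k).
Proof.
move=> cO loc.
have [->|/set0P[x0 Ox0]] := eqVneq Omega set0.
  by exists 0; apply: aeW => x.
have [U0 [k0 [U0x0 c0]]] := loc _ Ox0; exists k0.
pose B := Omega `&` \bigcup_(U in [set U | ae_const_open U w k0]) U.
have BO : B = Omega.
  apply: cO.
  - by exists x0; split => //; exists U0.
  - exists (\bigcup_(U in [set U | ae_const_open U w k0]) U) => //.
    by apply: bigcup_open => U [].
  - exists (~` (\bigcup_(U in
        [set U | exists2 k, k != k0 & ae_const_open U w k]) U)).
      by apply: open_closedC; apply: bigcup_open => U [k _ []].
    apply/seteqP; split => x [Ox].
      move=> [U cU Ux]; split => // -[U' [k /eqP kk cU'] U'x].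
      by apply: kk; apply: ae_const_open_uniq cU' cU _; exists x.
    move=> nx; split => //; have [U [k [Ux cU]]] := loc x Ox.
    have [kk|kk] := eqVneq k k0; first by exists U => //; rewrite /= -kk.
    by exfalso; apply: nx; exists U => //; exists k.
apply/ae_eq_on_negligible; apply: negligible_locally => x; rewrite -{1}BO.
move=> [_ [U [oU cU] Ux]]; exists U; split => //.
exact/ae_eq_on_negligible.
Qed.

(** Around each point, a closed square inside [Omega] provides the ramps, and
    the conclusion holds on the open square of half its size. *)
Lemma zero_gradient_ae_const (Omega : set (R * R)) w :
  open Omega -> connected Omega -> mu.-integrable setT (EFin \o w) ->
  (forall phi, test_function Omega phi -> pairing w (partial1 phi) = 0%E) ->
  (forall phi, test_function Omega phi -> pairing w (partial2 phi) = 0%E) ->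
  exists k, ae_eq_on Omega w (cst k).
Proof.
move=> oO cO iw w1 w2; apply: ae_const_connected => // x Ox.
have /nbhs_ballP[e /= e0 eO] : nbhs x Omega by exact: open_nbhs_nbhs.
pose d := e / 2; have d0 : 0 < d by rewrite divr_gt0.
(* [d] is small enough for the closed square of radius [d] to fit in the ball,
   and [h] smaller than [d] so that the half-open rectangle used below has its
   upper ends strictly inside that square. *)
pose h := d / 2; have h0 : 0 < h by rewrite divr_gt0.
have hE : d = h + h by rewrite /h -splitr.
have dE : e = d + d by rewrite /d -splitr.
have sub : `[x.1 - d, x.1 + d] `*` `[x.2 - d, x.2 + d] `<=` Omega.
  move=> y [] /=; rewrite !in_itv /= => /andP[h1 h2] /andP[h3 h4].
  by apply/eO/square_ball; split; rewrite /= in_itv /=; apply/andP; split; lra.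
have hh (t : R) : t - d < t + d by lra.
have [k Hk] := pairing_rectangle iw w1 w2 (hh x.1) (hh x.2) sub.
exists (square x.1 x.2 h), k; split.
  by split; rewrite /= in_itv /=; apply/andP; split; lra.
split; first exact: open_square.
have : ae_eq_on (`]x.1 - d, x.1 + h] `*` `]x.2 - d, x.2 + h]) w (cst k).
  apply: ae_cst_of_rectangles iw _ _ _; try by lra.
  by move=> p1 p2 q1 q2 *; apply: Hk => //; lra.
move=> H; apply: (@filterS _ _ (ae_filter_ringOfSetsType mu) _ _ _ H) => y Hy.
move=> [] /=; rewrite !in_itv /= => /andP[h1 h2] /andP[h3 h4].
by apply: Hy; split; rewrite /= in_itv /=; apply/andP; split; lra.
Qed.

End global.

(** * Charges, total variation and gradients *)

Section variation.
Context {R : realType}.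
Local Notation charge := ({charge set (plane R) -> \bar R}).
Implicit Types (Omega : set (R * R)) (nu : charge) (w v : @vmeasure R).

(** Hahn decompositions are not unique, and two charges that agree on [Omega]
    only may have unrelated ones. On [P1 `&` N2], inside [Omega], the common
    charge is both nonnegative and nonpositive, so both positive parts reduce
    to the value on [A `&` P1 `&` P2]. *)
Lemma jordan_pos_local Omega nu1 nu2 P1 N1 P2 N2
    (h1 : hahn_decomposition nu1 P1 N1) (h2 : hahn_decomposition nu2 P2 N2) :
  (forall A : set (plane R), measurable A -> A `<=` Omega -> nu1 A = nu2 A) ->
  forall A : set (plane R), measurable A -> A `<=` Omega ->
    jordan_pos h1 A = jordan_pos h2 A.
Proof.
move=> nu12 A mA AO.
have [[mP1 pos1] [mN1 neg1] PN1 PN10] := h1.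
have [[mP2 pos2] [mN2 neg2] PN2 PN20] := h2.
have sO B : A `&` B `<=` Omega by move=> x [/AO].
rewrite !jordan_posE !cjordan_posE /crestr0 /= mem_set // /crestr.
rewrite (charge_partition nu1 (measurableI _ _ mA mP1) mP2 mN2 PN2 PN20).
rewrite (charge_partition nu2 (measurableI _ _ mA mP2) mP1 mN1 PN1 PN10).
have -> : nu1 (A `&` P1 `&` N2) = 0%E.
  have m : measurable (A `&` P1 `&` N2) by do 2 apply: measurableI => //.
  apply/eqP; rewrite eq_le pos1 ?andbT //; last by move=> x [[]].
  by rewrite nu12 // -?setIA //; apply: neg2; rewrite ?setIA // => x [].
have -> : nu2 (A `&` P2 `&` N1) = 0%E.
  have m : measurable (A `&` P2 `&` N1) by do 2 apply: measurableI => //.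
  apply/eqP; rewrite eq_le pos2 ?andbT //; last by move=> x [[]].
  by rewrite -nu12 // -?setIA //; apply: neg1; rewrite ?setIA // => x [].
rewrite !adde0 setIAC nu12 //; first by do 2 apply: measurableI => //.
by rewrite -setIA.
Qed.

Lemma jordan_neg_local Omega nu1 nu2 P1 N1 P2 N2
    (h1 : hahn_decomposition nu1 P1 N1) (h2 : hahn_decomposition nu2 P2 N2) :
  (forall A : set (plane R), measurable A -> A `<=` Omega -> nu1 A = nu2 A) ->
  forall A : set (plane R), measurable A -> A `<=` Omega ->
    jordan_neg h1 A = jordan_neg h2 A.
Proof.
move=> nu12 A mA AO.
have E := jordan_pos_local h1 h2 nu12 mA AO.
have D1 : nu1 A = (jordan_pos h1 A - jordan_neg h1 A)%E.
  rewrite (jordan_decomp h1 mA); congr (_ + _)%E.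
  exact: (congr1 (fun f => f A) (cscaleN1 _)).
have D2 : nu2 A = (jordan_pos h2 A - jordan_neg h2 A)%E.
  rewrite (jordan_decomp h2 mA); congr (_ + _)%E.
  exact: (congr1 (fun f => f A) (cscaleN1 _)).
have fp : jordan_pos h2 A \is a fin_num by exact: fin_num_measure.
have f1 : jordan_neg h1 A \is a fin_num by exact: fin_num_measure.
have f2 : jordan_neg h2 A \is a fin_num by exact: fin_num_measure.
have := nu12 A mA AO; rewrite D1 D2 E -(fineK fp) -(fineK f1) -(fineK f2).
by rewrite -!EFinB => -[] /addrI /oppr_inj ->.
Qed.

(** The value of the distributional gradient on test functions depends on the
    measure through its restriction to [Omega] only. *)
Lemma charge_integral_local Omega nu1 nu2 phi :
  (forall A : set (plane R), measurable A -> A `<=` Omega -> nu1 A = nu2 A) ->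
  charge_integral nu1 Omega phi = charge_integral nu2 Omega phi.
Proof.
move=> nu12; rewrite /charge_integral; congr (_ - _)%E.
- by apply: eq_measure_integral; exact: jordan_pos_local.
- by apply: eq_measure_integral; exact: jordan_neg_local.
Qed.

Lemma vmeasure_subE w v (A : set (plane R)) :
  ((vmeasure_sub w v).1 A = w.1 A - v.1 A)%E /\
  ((vmeasure_sub w v).2 A = w.2 A - v.2 A)%E.
Proof. by []. Qed.

(** [A] and its complement in [Omega] form a partition, one term of which is
    the left-hand side. *)
Lemma total_variation_ge_norm Omega w (A : set (plane R)) :
  measurable (Omega : set (plane R)) -> measurable A -> A `<=` Omega ->
  ((euclidean_norm (fine (w.1 A)) (fine (w.2 A)))%:E <=
   total_variation_on Omega w)%E.
Proof.
move=> mO mA AO; pose F := bigcup2 A ((Omega : set (plane R)) `\` A).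
pose s i := (euclidean_norm (fine (w.1 (F i))) (fine (w.2 (F i))))%:E.
apply: (@le_trans _ _ (\sum_(i <oo) s i)%E).
  have s0 n : (0 <= n)%N -> xpredT n -> (0 <= s n)%E.
    by move=> _ _; rewrite lee_fin; exact: sqrtr_ge0.
  by have := nneseries_lim_ge 1 s0; rewrite big_nat1.
apply: ereal_sup_ubound; exists F; split => //.
- case=> [|[|n]]; rewrite /F /bigcup2 /=;
    [exact: mA|exact: measurableD|exact: measurable0].
- by rewrite /F -trivIset_bigcup2; apply/seteqP; split=> // x [Ax [_ /(_ Ax)]].
- by rewrite bigcup2E setDUK.
Qed.

Lemma euclidean_norm_le0 (a b : R) : euclidean_norm a b <= 0 -> a = 0 /\ b = 0.
Proof.
rewrite /euclidean_norm => h.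
have : Num.sqrt (a ^+ 2 + b ^+ 2) == 0 by rewrite eq_le h sqrtr_ge0.
rewrite sqrtr_eq0 => ab.
have a2 := sqr_ge0 a; have b2 := sqr_ge0 b.
by split; apply/eqP; rewrite -sqrf_eq0; apply/eqP; lra.
Qed.

Lemma total_variation_sub_le0 Omega w v : measurable (Omega : set (plane R)) ->
  (total_variation_on Omega (vmeasure_sub w v) <= 0)%E <->
  vmeasure_eq Omega w v.
Proof.
move=> mO; split=> [h A mA AO|h].
  have := le_trans (total_variation_ge_norm (vmeasure_sub w v) mO mA AO) h.
  rewrite lee_fin => /euclidean_norm_le0.
  have [-> ->] := vmeasure_subE w v A.
  have f1 : w.1 A \is a fin_num by exact: fin_num_measure.
  have f2 : w.2 A \is a fin_num by exact: fin_num_measure.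
  have g1 : v.1 A \is a fin_num by exact: fin_num_measure.
  have g2 : v.2 A \is a fin_num by exact: fin_num_measure.
  rewrite !fineB // => -[/eqP + /eqP]; rewrite !subr_eq0 => /eqP e1 /eqP e2.
  by split; rewrite -[LHS]fineK // -[RHS]fineK // ?e1 ?e2.
apply: ge_ereal_sup => _ [F [mF tF UF ->]].
rewrite eseries0 // => i _ _.
have [e1 e2] : w.1 (F i) = v.1 (F i) /\ w.2 (F i) = v.2 (F i).
  by apply: h => //; rewrite -UF; exact: bigcup_sup.
have [-> ->] := vmeasure_subE w v (F i).
have g1 : v.1 (F i) \is a fin_num by exact: fin_num_measure.
have g2 : v.2 (F i) \is a fin_num by exact: fin_num_measure.
by rewrite e1 e2 !subee // /euclidean_norm expr0n /= addr0 sqrtr0.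
Qed.

Lemma total_variation_on_ge0 Omega w : measurable (Omega : set (plane R)) ->
  (0 <= total_variation_on Omega w)%E.
Proof.
move=> mO; apply: le_trans (total_variation_ge_norm w mO measurable0 _).
  by rewrite lee_fin sqrtr_ge0.
by move=> x [].
Qed.

Lemma gradientP Omega u : in_BV Omega u ->
  is_gradient Omega u (gradient Omega u).
Proof.
move=> [_ ex]; rewrite /gradient; case: pselect => [h|/(_ ex)//].
exact: projT2 (cid h).
Qed.

End variation.

(** * Test functions, integrability and the quadratic constraint *)

Section quadratic.
Context {R : realType}.
Local Notation mu := (@leb2 R).
Implicit Types (Omega : set (R * R)) (f g u phi : R * R -> R).

Lemma bounded_leb2_lty Omega : measurable (Omega : set (plane R)) ->
  bounded_set Omega -> (mu Omega < +oo)%E.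
Proof.
move=> mO [M [_ HM]]; pose K := `|M| + 1.
have OK : (Omega : set (plane R)) `<=` `]- (K + 1), K] `*` `]- (K + 1), K].
  move=> x Ox; have : `|x| <= K.
    by apply: HM => //; rewrite (le_lt_trans (ler_norm _)) // ltrDl.
  rewrite prod_normE /= ge_max !ler_norml => /andP[/andP[h1 h2] /andP[h3 h4]].
  by split; rewrite /= in_itv /=; apply/andP; split => //; lra.
have K0 : - (K + 1) <= K by have := normr_ge0 M; rewrite /K; lra.
apply: le_lt_trans (le_measure _ _ _ OK) _; rewrite ?inE //.
  by apply: measurableX; exact: measurable_itv.
by rewrite [X in (X < _)%E](leb2_rect K0 K0) ltry.
Qed.

Lemma continuous_measurable_plane phi : continuous phi ->
  measurable_fun setT (phi : plane R -> R).
Proof.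
move=> /continuousP cphi; apply: (measurability _ (RGenOpens.measurableE R)).
move=> _ [_ [a [b ->] <-]]; rewrite setTI; apply: open_measurable2.
exact/cphi/interval_open.
Qed.

Lemma compactly_supported_bounded phi (S : set (R * R)) :
  continuous phi -> compact S -> (forall x, ~ S x -> phi x = 0) ->
  exists M, forall x, `|phi x| <= M.
Proof.
move=> cphi cS phi0.
have := compact_bounded (continuous_compact (continuous_subspaceT cphi) cS).
move=> [M [_ HM]]; exists (`|M| + 1) => x.
have [Sx|nSx] := pselect (S x); last by rewrite phi0 // normr0 addr_ge0.
apply: (HM (`|M| + 1)); first by rewrite (le_lt_trans (ler_norm _)) // ltrDl.
by exists x.
Qed.

(** Near a point outside the support the function vanishes, and so do its
    partial derivatives; on the support they are continuous on a compact. *)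
Lemma test_function_partials_bounded Omega phi : test_function Omega phi ->
  [/\ continuous (partial1 phi), continuous (partial2 phi) &
    exists M, forall x, `|partial1 phi x| <= M /\ `|partial2 phi x| <= M].
Proof.
move=> [ck cS _].
have [_ [_ _ [c1 _] [c2 _]]] := ck 1%N; split => //.
have near0 x : ~ closure [set x | phi x != 0] x -> \near x, phi x = 0.
  move=> nx; have : nbhs x (~` closure [set x | phi x != 0]).
    by apply: open_nbhs_nbhs; split => //; exact/closed_openC/closed_closure.
  apply: filterS => y ny; apply/eqP; apply: contrapT => /negP py.
  by apply: ny; exact: subset_closure.
have cp1 (x : R * R) : (fun t : R => (t, x.2)) @ x.1 --> (x.1, x.2).
  apply: (cvg_pair (F := nbhs x.1) (G := nbhs x.1) (H := nbhs x.2) (f := id)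
    (g := cst x.2)); [exact: cvg_id|exact: cvg_cst].
have cp2 (x : R * R) : (fun t : R => (x.1, t)) @ x.2 --> (x.1, x.2).
  apply: (cvg_pair (F := nbhs x.2) (G := nbhs x.1) (H := nbhs x.2)
    (f := cst x.1) (g := id)); [exact: cvg_cst|exact: cvg_id].
have [M1 H1] : exists M, forall x, `|partial1 phi x| <= M.
  apply: compactly_supported_bounded c1 cS _ => x /near0 nx.
  rewrite (surjective_pairing x) in nx.
  exact: (derive1_near_cst (cp1 x _ nx)).
have [M2 H2] : exists M, forall x, `|partial2 phi x| <= M.
  apply: compactly_supported_bounded c2 cS _ => x /near0 nx.
  rewrite (surjective_pairing x) in nx.
  exact: (derive1_near_cst (cp2 x _ nx)).
exists (Num.max M1 M2) => x.
by split; [apply: (le_trans (H1 x))|apply: (le_trans (H2 x))];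
  rewrite le_max lexx ?orbT.
Qed.

Lemma restrict_sub Omega u f : (u \- f) \_ Omega = (u \_ Omega \- f \_ Omega).
Proof.
apply/funext => x; rewrite /= !patchE; case: ifP => // _.
by rewrite /point /= subr0.
Qed.

Lemma integrable_indic_lty (A : set (plane R)) :
  measurable A -> (mu A < +oo)%E ->
  mu.-integrable setT (EFin \o (\1_A : plane R -> R)).
Proof.
move=> mA Afin; apply/integrableP; split.
  by apply/measurable_EFinP; exact: measurable_indic.
rewrite (eq_integral (fun x => (\1_A x)%:E)) => [|x _].
  by rewrite integral_indic // setIT.
by rewrite /= ger0_norm // indicE.
Qed.

Lemma in_Lp_measurable p Omega f : in_Lp p Omega f ->
  measurable_fun setT (f \_ Omega : plane R -> R).
Proof. by rewrite /in_Lp inE => /andP[]; rewrite inE. Qed.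

(** On a set of finite measure, [|f|] is at most [1 + f^2]. *)
Lemma in_Lp2_integrable Omega f : measurable (Omega : set (plane R)) ->
  (mu Omega < +oo)%E -> in_Lp 2%E Omega f -> in_Lp 1%E Omega f.
Proof.
move=> mO Ofin f2; apply/Lfun1_integrable.
have isq := Lfun2_integrable_sqr f2.
have i1 : mu.-integrable setT (EFin \o (\1_Omega : plane R -> R)).
  exact: integrable_indic_lty.
apply: le_integrable (integrableD measurableT i1 isq) => //.
  by apply/measurable_EFinP; exact: in_Lp_measurable f2.
move=> x _ /=; rewrite lee_fin indicE patchE.
case: ifPn => Ox /=; last by rewrite normr0.
apply: le_trans (ler_norm _).
rewrite -(real_normK (num_real (f x))).
by have := sqr_ge0 (`|f x| - 1); have := sqr_ge0 `|f x|; lra.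
Qed.

Lemma L2norm_sqr Omega u :
  (L2norm Omega u `^ 2 = \int[mu]_x (((u \_ Omega) x) ^+ 2)%:E)%E.
Proof.
rewrite /L2norm poweR_Lnorm //; apply: eq_integral => x _ /=.
by rewrite powR_mulrn // real_normK // num_real.
Qed.

Lemma L2norm_le_sqr Omega u f : (L2norm Omega u <= L2norm Omega f)%E ->
  (\int[mu]_x (((u \_ Omega) x) ^+ 2)%:E <=
   \int[mu]_x (((f \_ Omega) x) ^+ 2)%:E)%E.
Proof.
move=> h; rewrite -!L2norm_sqr; apply: gt0_ler_poweR => //.
- by rewrite in_itv /= leey Lnorm_ge0.
- by rewrite in_itv /= leey Lnorm_ge0.
Qed.

(** The cross term in the expansion of the square of [f + k] is [2 k] times the
    integral of [f], so only [k^2 |Omega|] remains, with [|Omega| > 0]. *)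
Lemma mean_zero_translation Omega f g k :
  open Omega -> Omega !=set0 -> (mu Omega < +oo)%E ->
  in_Lp 2%E Omega f -> in_Lp 2%E Omega g ->
  (\int[mu]_x ((f \_ Omega) x)%:E = 0)%E ->
  {ae mu, forall x, Omega x -> g x = f x + k} ->
  (L2norm Omega g <= L2norm Omega f)%E -> k = 0.
Proof.
move=> oO O0 Ofin f2 g2 f0 gfk /L2norm_le_sqr.
have mO := open_measurable2 oO.
have if1 : mu.-integrable setT (EFin \o (f \_ Omega)).
  by apply/Lfun1_integrable; exact: in_Lp2_integrable.
have if2 := Lfun2_integrable_sqr f2.
have ig2 := Lfun2_integrable_sqr g2.
have i1 : mu.-integrable setT (EFin \o (\1_Omega : plane R -> R)).
  exact: integrable_indic_lty.
pose h x := ((((f \_ Omega) x) ^+ 2)%:E +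
  ((2 * k)%:E * ((f \_ Omega) x)%:E + (k ^+ 2)%:E * (\1_Omega x)%:E))%E.
have i3 : mu.-integrable setT (fun x => (2 * k)%:E * ((f \_ Omega) x)%:E)%E.
  exact: integrableZl.
have i4 : mu.-integrable setT
    (fun x => (k ^+ 2)%:E * ((\1_Omega : plane R -> R) x)%:E)%E.
  exact: integrableZl.
have i34 := integrableD measurableT i3 i4.
have ih := integrableD measurableT if2 i34.
rewrite (@ae_eq_integral _ _ _ mu setT h) //; last 3 first.
- exact: measurable_int ig2.
- exact: measurable_int ih.
- apply: (@filterS _ _ (ae_filter_ringOfSetsType mu) _ _ _ gfk) => x /= gx _.
  rewrite /h !patchE indicE.
  case: ifPn => /= Ox; last first.
    by rewrite /point /= expr0n /= !mule0 !adde0.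
  have {}Ox : Omega x by move: Ox; rewrite inE.
  rewrite gx //.
  by rewrite -!EFinM -!EFinD; congr EFin; ring.
rewrite /h integralD //.
rewrite (integralD measurableT i3 i4) // integralZl // f0 mule0 add0e.
rewrite integralZl // integral_indic // setIT.
have fin : (\int[mu]_x ((f \_ Omega) x ^+ 2)%:E)%E \is a fin_num.
  exact: integrable_fin_num.
rewrite -[X in (_ <= X)%E -> _]adde0 leeD2lE //.
have Opos := open_leb2_gt0 oO O0.
have Of : mu Omega \is a fin_num by rewrite ge0_fin_numE.
rewrite -(fineK Of) -EFinM lee_fin pmulr_lle0; last by rewrite fine_gt0 // Opos.
move=> k2; apply/eqP; rewrite -sqrf_eq0 eq_le k2; exact: sqr_ge0.
Qed.

End quadratic.

(** * Uniqueness of the minimizer *)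

Section uniqueness.
Context {R : realType}.
Local Notation mu := (@leb2 R).
Implicit Types (Omega : set (R * R)) (u f phi : R * R -> R).

Lemma pairing_restrict Omega u phi :
  pairing (u \_ Omega) phi = (\int[mu]_(x in Omega) (u x * phi x)%:E)%E.
Proof.
rewrite /pairing [RHS]integral_mkcond; apply: eq_integral => x _.
by rewrite !patchE; case: ifP => // _; rewrite /point /= mul0r.
Qed.

(** The two integrals cannot be subtracted before they are known to be finite,
    which is what boundedness of [phi] ensures. *)
Lemma pairing_sub0 Omega u f phi M :
  mu.-integrable setT (EFin \o (u \_ Omega)) ->
  mu.-integrable setT (EFin \o (f \_ Omega)) ->
  continuous phi -> (forall x, `|phi x| <= M) ->
  (\int[mu]_(x in Omega) (u x * phi x)%:E =
   \int[mu]_(x in Omega) (f x * phi x)%:E)%E ->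
  pairing ((u \- f) \_ Omega) phi = 0%E.
Proof.
move=> iu jf cphi phiM E.
have mphi := continuous_measurable_plane cphi.
have i1 := integrable_mul_bounded iu mphi phiM.
have i2 := integrable_mul_bounded jf mphi phiM.
have sub0 : (pairing (u \_ Omega) phi - pairing (f \_ Omega) phi = 0)%E.
  rewrite !pairing_restrict E subee // -pairing_restrict.
  exact: integrable_fin_num i2.
rewrite -[RHS]sub0 -(integralB measurableT i1 i2).
apply: eq_integral => x _.
by rewrite restrict_sub /= mulrBl EFinB.
Qed.

Lemma equal_gradients_ae_const Omega u f :
  open Omega -> connected Omega -> in_BV Omega u -> in_BV Omega f ->
  vmeasure_eq Omega (gradient Omega u) (gradient Omega f) ->
  exists k, {ae mu, forall x, Omega x -> u x = f x + k}.
Proof.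
move=> oO cO BVu BVf guf.
have iu := proj1 (Lfun1_integrable _ _) BVu.1.
have jf := proj1 (Lfun1_integrable _ _) BVf.1.
have iw : mu.-integrable setT (EFin \o ((u \- f) \_ Omega)).
  by rewrite restrict_sub; have := integrableB measurableT iu jf.
have [k wk] : exists k, ae_eq_on Omega ((u \- f) \_ Omega) (cst k).
  apply: zero_gradient_ae_const => // phi tphi;
    have [c1 c2 [M HM]] := test_function_partials_bounded tphi;
    have [u1 u2] := gradientP BVu tphi; have [f1 f2] := gradientP BVf tphi.
  - have gE : charge_integral (gradient Omega u).1 Omega phi =
        charge_integral (gradient Omega f).1 Omega phi.
      by apply: charge_integral_local => A mA AO; have [] := guf A mA AO.
    apply: (pairing_sub0 iu jf c1 (fun x => (HM x).1)).
    exact: etrans u1 (etrans (congr1 oppe gE) (esym f1)).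
  - have gE : charge_integral (gradient Omega u).2 Omega phi =
        charge_integral (gradient Omega f).2 Omega phi.
      by apply: charge_integral_local => A mA AO; have [] := guf A mA AO.
    apply: (pairing_sub0 iu jf c2 (fun x => (HM x).2)).
    exact: etrans u2 (etrans (congr1 oppe gE) (esym f2)).
exists k.
apply: (@filterS _ _ (ae_filter_ringOfSetsType mu) _ _ _ wk) => x + Ox.
by rewrite patchE mem_set // => /(_ Ox) /= <-; rewrite addrC subrK.
Qed.

End uniqueness.

Theorem lemma1 (R : realType) (Omega : set (R * R)) (u0 udag : R * R -> R)
    (v : @vmeasure R) (delta1 : \bar R) :
  bounded_domain Omega ->
  in_Lp 2%E Omega u0 ->
  in_Lp 2%E Omega udag ->
  in_BV Omega udag ->
  (\int[leb2]_(x in Omega) (udag x)%:E = \int[leb2]_(x in Omega) (u0 x)%:E)%E ->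
  vmeasure_eq Omega v (gradient Omega udag) ->
  delta1 = L2norm Omega (udag \- u0) ->
  is_solution Omega u0 v delta1 udag /\
  (forall u : R * R -> R,
     is_solution Omega u0 v delta1 u -> ae_eq_on Omega u udag).
Proof.
move=> [oO cO bO] L0 Ld BVd mean vgrad ->.
have mO := open_measurable2 oO.
have obj0 : (objective Omega v udag <= 0)%E.
  apply/(total_variation_sub_le0 _ _ mO) => A mA AO.
  by have [-> ->] := vgrad A mA AO.
have fd : feasible Omega u0 (L2norm Omega (udag \- u0)) udag by split.
split.
  split; first exact: fd.
  move=> u' _; apply: (le_trans obj0); exact: (total_variation_on_ge0 _ mO).
move=> u [[Lu BVu ule] /(_ _ fd) umin].
have gu : vmeasure_eq Omega (gradient Omega u) (gradient Omega udag).
  have uv : vmeasure_eq Omega (gradient Omega u) v.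
    by apply/(total_variation_sub_le0 _ _ mO); exact: (le_trans umin obj0).
  by move=> A mA AO; have [-> ->] := uv A mA AO; exact: vgrad.
have [k uk] := equal_gradients_ae_const oO cO BVu BVd gu.
have [->|/set0P O0] := eqVneq Omega set0; first by apply: aeW => x [].
have Ofin := bounded_leb2_lty mO bO.
have sub2 f g : in_Lp 2%E Omega f -> in_Lp 2%E Omega g ->
    in_Lp 2%E Omega (f \- g).
  move=> f2 g2; rewrite /in_Lp restrict_sub.
  apply: (@Lfun_addr_closed _ _ _ leb2 2%E (lee1n 2)).2 => //.
  exact: (@Lfun_oppr_closed _ _ _ leb2 2%E).
have mean0 : (\int[leb2]_x (((udag \- u0) \_ Omega) x)%:E = 0)%E.
  have i1 := proj1 (Lfun1_integrable _ _) (in_Lp2_integrable mO Ofin Ld).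
  have i2 := proj1 (Lfun1_integrable _ _) (in_Lp2_integrable mO Ofin L0).
  have E f : (\int[leb2]_x ((f \_ Omega) x)%:E =
      \int[leb2]_(x in Omega) (f x)%:E)%E.
    rewrite [RHS]integral_mkcond; apply: eq_integral => x _.
    by rewrite !patchE; case: ifP.
  have D : (\int[leb2]_x ((udag \_ Omega) x)%:E -
            \int[leb2]_x ((u0 \_ Omega) x)%:E = 0)%E.
    by rewrite !E mean subee // -E; exact: integrable_fin_num i2.
  rewrite -[RHS]D -(integralB measurableT i1 i2); apply: eq_integral => x _.
  by rewrite restrict_sub /= EFinB.
have k0 : k = 0.
  apply: (mean_zero_translation oO O0 Ofin (sub2 _ _ Ld L0) (sub2 _ _ Lu L0)
    mean0 _ ule).
  apply: (@filterS _ _ (ae_filter_ringOfSetsType leb2) _ _ _ uk) => x ux Ox.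
  by rewrite /= ux // addrAC.
apply: (@filterS _ _ (ae_filter_ringOfSetsType leb2) _ _ _ uk) => x ux Ox.
by rewrite ux // k0 addr0.
Qed.
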